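(* For each $n\in\mathbb{N}$, there is a finite non-abelian group whose commuting graph has chromatic number equal to $2n$.
   Context: Here $\mathbb{N}=\{1,2,3,\ldots\}$. The commuting graph of a finite non-abelian group $G$ is the simple graph with vertex set $G\setminus Z(G)$, where $Z(G)$ is the center of $G$ (so central elements, including the identity, are not vertices), in which two distinct vertices $x,y$ are adjacent if and only if $xy=yx$. The chromatic number of a simple graph is the minimum number of colours needed to colour its vertices so that adjacent vertices have distinct colours. *)

(* Defs.v *)
From HB Require Import structures.
From mathcomp Require Import all_boot all_fingroup all_solvable.

Set Implicit Arguments.
Unset Strict Implicit.
Unset Printing Implicit Defensive.

Record sgraph := SGraph {
  vertex : finType;
  adj : rel vertex;
  adj_sym : symmetric adj;
  adj_irrefl : irreflexive adj
}.

Definition proper_coloring (X : sgraph) (C : eqType) (f : vertex X -> C) : Prop :=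
  forall x y : vertex X, adj x y -> f x != f y.

Definition colorable (X : sgraph) (k : nat) : bool :=
  [exists f : {ffun vertex X -> 'I_k},
    [forall x, forall y, adj x y ==> (f x != f y)]].

Lemma colorableP (X : sgraph) (k : nat) :
  reflect (exists f : vertex X -> 'I_k, proper_coloring f) (colorable X k).
Proof.
apply: (iffP existsP) => [[f /forallP fP]|[f fP]].
  by exists f => x y; have /forallP/(_ y)/implyP := fP x.
exists (finfun f); apply/forallP => x; apply/forallP => y; apply/implyP => xy.
by rewrite !ffunE; apply: fP.
Qed.

Lemma colorable_card (X : sgraph) : exists k, colorable X k.
Proof.
exists #|vertex X|; apply/colorableP; exists enum_rank => x y.
by apply: contraTneq => /enum_rank_inj ->; rewrite adj_irrefl.
Qed.

Definition chromatic_number (X : sgraph) : nat := ex_minn (colorable_card X).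

Section CommutingGraph.

Variables (gT : finGroupType) (G : {group gT}).

Definition noncentral := {x : gT | (x \in G :\: 'Z(G))%g}.

Definition commuting_adj : rel noncentral :=
  fun x y => (x != y) && (val x * val y == val y * val x)%g.

Lemma commuting_adj_sym : symmetric commuting_adj.
Proof. by move=> x y; rewrite /commuting_adj (eq_sym x) (eq_sym (_ * _)%g). Qed.

Lemma commuting_adj_irrefl : irreflexive commuting_adj.
Proof. by move=> x; rewrite /commuting_adj eqxx. Qed.

Definition commuting_graph : sgraph :=
  SGraph commuting_adj_sym commuting_adj_irrefl.

End CommutingGraph.

(* Main.v *)
Require Import Defs.
From HB Require Import structures.
From mathcomp Require Import all_boot all_fingroup all_solvable.
From mathcomp Require Import ssralg finalg zmodp.

Set Implicit Arguments.
Unset Strict Implicit.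
Unset Printing Implicit Defensive.

Import GRing.Theory.

(** In the generalized dihedral group of an abelian group [A] of odd order,
    nontrivial rotations form a clique of size [#|A| - 1], while a reflection
    commutes only with itself and the identity, hence is an isolated vertex.
    So the chromatic number is [#|A| - 1]; take [A] cyclic of order [2n + 1]. *)

Local Open Scope ring_scope.

Definition gdihedral (A : finZmodType) : Type := (A * bool)%type.

Section GeneralizedDihedral.

Variable A : finZmodType.

HB.instance Definition _ := Finite.copy (gdihedral A) (A * bool)%type.

(** The pair [(a, false)] stands for the map z -> a + z of [A] and [(a, true)] for z -> a - z; the
    product is composition of maps. *)
Definition gdi_mul (x y : gdihedral A) : gdihedral A :=
  (x.1 + (if x.2 then - y.1 else y.1), x.2 (+) y.2).
Definition gdi_one : gdihedral A := (0, false).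
Definition gdi_inv (x : gdihedral A) : gdihedral A :=
  (if x.2 then x.1 else - x.1, x.2).

Lemma gdi_mulA : associative gdi_mul.
Proof.
move=> [a s] [b t] [c u]; rewrite /gdi_mul /= addbA -addrA.
by case: s t => [] [] //=; rewrite ?opprD ?opprK.
Qed.

Lemma gdi_mul1 : left_id gdi_one gdi_mul.
Proof. by case=> a s; rewrite /gdi_mul /= add0r. Qed.

Lemma gdi_mulV : left_inverse gdi_one gdi_inv gdi_mul.
Proof. by case=> a [] /=; rewrite /gdi_mul /= ?subrr ?addNr. Qed.

HB.instance Definition _ :=
  Finite_isGroup.Build (gdihedral A) gdi_mulA gdi_mul1 gdi_mulV.

(** Odd order of [A] enters only in this form, as absence of 2-torsion. *)
Hypothesis A2 : forall a : A, a + a = 0 -> a = 0.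

Lemma gdi_mulE (x y : gdihedral A) :
  (x * y)%g = (x.1 + (if x.2 then - y.1 else y.1), x.2 (+) y.2).
Proof. by []. Qed.

Lemma rotation_commute (a b : A) :
  commute ((a, false) : gdihedral A) ((b, false) : gdihedral A).
Proof. by rewrite /commute !gdi_mulE /= addrC. Qed.

(** Commuting with [(b, true)] means a - b = b - a, so 2(b - a) = 0; commuting with [(b, false)]
    means a - b = b + a, so 2b = 0. *)
Lemma reflection_commute (a : A) (y : gdihedral A) :
  commute ((a, true) : gdihedral A) y -> y = (0, false) \/ y = (a, true).
Proof.
rewrite /commute !gdi_mulE; case: y => b [] [] /= eq_ab; [right | left].
  congr pair; apply/eqP; rewrite -subr_eq0; apply/eqP/A2.
  by rewrite -{1}eq_ab addrA subrK subrr.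
congr pair; apply: A2; apply: (addrI a).
by rewrite addr0 addrA (addrC a) -eq_ab subrK.
Qed.

Variables (a0 : A) (a0_neq0 : a0 != 0).

Let G : {group gdihedral A} := [set: gdihedral A]%G.

(** A reflection fails to commute with the rotation by [a0], and a nontrivial rotation with the
    reflection [(0, true)]. *)
Lemma gdi_center (x : gdihedral A) : x \in 'Z(G)%g -> x = (0, false).
Proof.
case: x => a [] /centerP[_ xC].
  by case/reflection_commute: (xC (a0, false) (in_setT _)) => // -[/eqP];
     rewrite (negPf a0_neq0).
by case/esym/reflection_commute: (xC (0, true) (in_setT _)).
Qed.

Lemma gdi_nonabelian : ~~ abelian G.
Proof.
apply/negP => /center_idP GZ.
have : ((0, true) : gdihedral A) \in 'Z(G)%g by rewrite GZ in_setT.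
by move/gdi_center.
Qed.

Lemma rotation_noncentral (a : A) :
  a != 0 -> ((a, false) : gdihedral A) \in (G :\: 'Z(G))%g.
Proof.
by move=> a_neq0; rewrite in_setD in_setT andbT; apply: contra a_neq0 => /gdi_center[->].
Qed.

Lemma gdi_colorable : colorable (commuting_graph G) #|A|.-1.
Proof.
have a0P : a0 \in [set~ 0] by rewrite !inE.
rewrite -(cardsC1 0); apply/colorableP.
(* The colours are the nonzero elements of [A]: each rotation has its own, and the reflections,
   being isolated, can all share [a0]. *)
exists (fun x : noncentral G =>
  enum_rank_in a0P (if (val x).2 then a0 else (val x).1)).
have id_noncentral : ((0, false) : gdihedral A) \notin (G :\: 'Z(G))%g.
  by rewrite inE group1.
move=> [x xP] [y yP] /andP[/= xy /eqP xyC].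
have {}xy : x != y by apply: contraNneq xy => eq_xy; apply/eqP/val_inj.
case: x y xP yP xy xyC => a [] [b t] xP yP xy xyC.
  case: (reflection_commute xyC) => eq_y; last by rewrite eq_y eqxx in xy.
  by rewrite eq_y (negPf id_noncentral) in yP.
case: t yP xy xyC => yP xy xyC.
  case: (reflection_commute (esym xyC)) => // eq_x.
  by rewrite eq_x (negPf id_noncentral) in xP.
(* Two rotations remain. [enum_rank_in] is injective only on the nonzero elements; both angles are
   nonzero since the identity is central. *)
rewrite /=; apply: contra xy => /eqP/enum_rank_in_inj -> //; rewrite !inE.
  by apply: contraNneq id_noncentral => <-.
by apply: contraNneq id_noncentral => <-.
Qed.

(** A proper colouring is injective on the clique of nontrivial rotations. *)
Lemma gdi_colorable_ge k : colorable (commuting_graph G) k -> #|A|.-1 <= k.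
Proof.
case/colorableP => f f_proper.
pose rot (u : {a : A | a != 0}) : noncentral G :=
  Sub ((val u, false) : gdihedral A) (rotation_noncentral (valP u)).
have f_inj : injective (f \o rot).
  move=> u v /eqP; apply: contraTeq => uv; apply: f_proper; apply/andP; split.
    by apply: contra uv => /eqP[eq_uv]; apply/eqP/val_inj.
  by apply/eqP/rotation_commute.
by have := leq_card _ f_inj; rewrite card_ord card_sig (cardC1 0).
Qed.

Lemma chromatic_number_gdihedral :
  chromatic_number (commuting_graph G) = #|A|.-1.
Proof.
rewrite /chromatic_number; case: ex_minnP => m m_col m_min.
by apply/eqP; rewrite eqn_leq m_min ?gdi_colorable //= gdi_colorable_ge.
Qed.

End GeneralizedDihedral.

Lemma ord_odd_2torsion_free (n : nat) (a : 'I_(2 * n).+1) :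
  a + a = 0 -> a = 0.
Proof.
move=> /(congr1 val) /= /eqP; rewrite -/(dvdn _ _) addnn -mul2n => dvd_2a.
apply: val_inj => /=; apply/eqP; move: dvd_2a.
(* As 2n + 1 is coprime to 2, it divides a itself, and a < 2n + 1 leaves only 0. *)
rewrite Gauss_dvdr; last by rewrite coprimen2 /= oddM.
by rewrite /dvdn modn_small.
Qed.

Local Close Scope ring_scope.

Theorem theorem5p3 (n : nat) (hn : (0 < n)%N) :
  exists (gT : finGroupType) (G : {group gT}),
    ~~ abelian G /\ chromatic_number (commuting_graph G) = (2 * n)%N.
Proof.
(* The element 2n serves as [a0]; it is nonzero because n > 0. *)
have max_neq0 : (ord_max : 'I_(2 * n).+1) != 0%R.
  by rewrite -val_eqE /= muln_eq0 -lt0n.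
exists (gdihedral 'I_(2 * n).+1), [set: gdihedral _]%G; split.
  exact: gdi_nonabelian (@ord_odd_2torsion_free n) _ max_neq0.
rewrite (chromatic_number_gdihedral (@ord_odd_2torsion_free n) max_neq0).
by rewrite card_ord.
Qed.
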